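(* Let $X$ be an oriented rank three nondegenerate WSD manifold and let $\mathcal{L}_{\mathbf 3}$ be the real Lie superalgebra generated by the operators $\imath L_j,\imath V_j,\imath\Lambda_j,A_j$ ($j=0,1,2$). Then at every point $p\in X$ the algebra $\mathcal{L}_{\mathbf 3}$, acting on $\bigwedge^*_{\mathbb C}T^*_pX$, commutes with the action of $\mathbf{SO}(3,\mathbb R)$.
   Context: WSD manifolds. An oriented rank three nondegenerate WSD manifold is an oriented smooth manifold $X$ of dimension $9$ with a Riemannian metric and closed smooth $2$-forms $\omega_1,\omega_2,\omega_D$ such that the distribution $\omega_1^0+\omega_2^0$ is integrable ($\omega_i^0\subset TX$ is the kernel of $\omega_i$), and such that every $T_p^*X$ has an orthonormal basis $v_{ij}$ ($i=1,2,3$, $j=0,1,2$), called an adapted coframe, with $\omega_1=\sum_i v_{i0}\wedge v_{i1}$, $\omega_2=\sum_i v_{i0}\wedge v_{i2}$, $\omega_D=\sum_i v_{i1}\wedge v_{i2}$ at $p$. The spaces $W_j=\mathrm{span}_{\mathbb R}(v_{1j},v_{2j},v_{3j})$ and the identifications $W_0\cong W_1\cong W_2$, $v_{i0}\leftrightarrow v_{i1}\leftrightarrow v_{i2}$, do not depend on the adapted coframe; $W_0\cong W_1\cong W_2$ are oriented so that $T_p^*X=W_0\oplus W_1\oplus W_2$ has the given orientation, and adapted coframes are always chosen with $(v_{1j},v_{2j},v_{3j})$ oriented. Put $Vol(W_j)=v_{1j}\wedge v_{2j}\wedge v_{3j}$. Operators. On complex forms put $L_0=\omega_D\wedge\cdot$,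 $L_1=-\omega_2\wedge\cdot$, $L_2=\omega_1\wedge\cdot$, $V_j=Vol(W_j)\wedge\cdot$. Let $(\ ,\ )_p$ be the Hermitean inner product on $\bigwedge^*_{\mathbb C}T^*_pX$ induced by the metric. For a homogeneous operator $\phi$, $\phi^\star$ is defined by $(\phi(\alpha),\beta)_p=(-1)^{\deg(\phi)\deg(\alpha)}(\alpha,\phi^\star(\beta))_p$ for homogeneous $\alpha,\beta$. Put $\Lambda_j=L_j^\star$, $A_j=V_j^\star$. Operators form a Lie superalgebra under the supercommutator, with $\mathbb Z/2$-grading induced by parity of the degree of forms. $\mathcal{L}_{\mathbf 3}$ is the real Lie subalgebra of the general linear Lie superalgebra of $\Omega^*_{\mathbb C}(X)$ generated by $\imath L_j,\imath V_j,\imath\Lambda_j,A_j$, $j=0,1,2$; its elements act fibrewise on $\bigwedge^*_{\mathbb C}T^*_pX$. The $\mathbf{SO}(3,\mathbb R)$-action. At $p$, $\mathbf{SO}(3,\mathbb R)$ acts on $T_p^*X\cong \mathrm{span}(v_{10},v_{20},v_{30})\otimes\mathbb R^3$ (where $v_{ij}=v_{i0}\otimes e_j$) by the standard action in the index $i$, simultaneously for $j=0,1,2$, and on $\bigwedge^*_{\mathbb C}T^*_pX$ by the induced action by algebra automorphisms. Its Lie algebra is spanned by the derivations $J_1,J_2,J_3$ with, for all $j$: $J_1v_{2j}=v_{3j}$, $J_1v_{3j}=-v_{2j}$, $J_1v_{1j}=0$; $J_2v_{3j}=v_{1j}$, $J_2v_{1j}=-v_{3j}$, $J_2v_{2j}=0$;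 $J_3v_{1j}=v_{2j}$, $J_3v_{2j}=-v_{1j}$, $J_3v_{3j}=0$. *)

(* Defs.v *)
From HB Require Import structures.
From mathcomp Require Import all_boot all_order all_algebra.
From mathcomp Require Import all_classical all_reals all_analysis.
From mathcomp Require Import complex.

Set Implicit Arguments.
Unset Strict Implicit.
Unset Printing Implicit Defensive.

Import Order.TTheory GRing.Theory Num.Theory.
Import numFieldNormedType.Exports.

Local Open Scope classical_set_scope.
Local Open Scope ring_scope.
Local Open Scope complex_scope.

(* [alpha I] is the coefficient of e_{i1} /\ ... /\ e_{ik}, where
   I = {i1 < ... < ik}.  Vectors are rows, and matrices act on the right. *)
Notation ext K n := {ffun {set 'I_n} -> K^o}.

Section ExteriorAlgebra.
Variables (K : comNzRingType) (n : nat).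
Implicit Types (alpha beta : ext K n) (I J : {set 'I_n}).

Definition ext_basis J : ext K n := [ffun I => (I == J)%:R].

(* (-1) to the number of inversions of the concatenation of I and J, so that
   e_I /\ e_J = ext_sign I J e_(I :|: J) for disjoint I and J. *)
Definition ext_sign I J : K :=
  (-1) ^+ #|[set ij in finset.setX I J | (ij.2 < ij.1)%N]|.

Definition wedge alpha beta : ext K n :=
  [ffun I : {set 'I_n} => \sum_(J : {set 'I_n} | J \subset I)
     ext_sign J (I :\: J) * alpha J * beta (I :\: J)].

Definition ext1 : ext K n := ext_basis finset.set0.

Definition evec (u : 'rV[K]_n) : ext K n :=
  \sum_(i < n) u 0 i *: ext_basis (finset.set1 i).

(* The algebra endomorphism induced by the linear map u |-> u *m A. *)
Definition extmap (A : 'M[K]_n) alpha : ext K n :=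
  \sum_(I : {set 'I_n})
    alpha I *: \big[wedge/ext1]_(i in I) evec (row i A).

Definition homog (k : nat) alpha := forall I, alpha I != 0 -> #|I| = k.

(* Value of the degree two part on a pair of vectors, with the convention
   (a /\ b)(u, w) = a(u) b(w) - a(w) b(u). *)
Definition eval2 alpha (u w : 'rV[K]_n) : K :=
  \sum_(i < n) \sum_(j < n | (i < j)%N)
    alpha (finset.setU (finset.set1 i) (finset.set1 j)) *
      (u 0 i * w 0 j - w 0 i * u 0 j).

Definition form_kernel alpha : set 'rV[K]_n :=
  [set u | forall w, eval2 alpha u w = 0].

End ExteriorAlgebra.

Section Hermitian.
Variables (R : realType) (n : nat).

Definition complexify (alpha : ext R n) : ext R[i] n :=
  [ffun I => (alpha I)%:C].

(* Gram determinant (e_I, e_J), where G i j = (e_i, e_j). *)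
Definition gram_minor (G : 'M[R]_n) (I J : {set 'I_n}) : R :=
  if #|I| == #|J| then
    \det (\matrix_(a < #|I|, b < #|I|)
            G (enum_val a) (nth (enum_val a) (enum J) b))
  else 0.

Definition hdot (G : 'M[R]_n) (alpha beta : ext R[i] n) : R[i] :=
  \sum_(I : {set 'I_n}) \sum_(J : {set 'I_n})
    (gram_minor G I J)%:C * alpha I * (beta J)^*.

(* [psi] is the superadjoint of the operator [phi], homogeneous of degree d. *)
Definition superadjoint (G : 'M[R]_n) (d : nat)
    (phi psi : ext R[i] n -> ext R[i] n) : Prop :=
  forall k l alpha beta, homog k alpha -> homog l beta ->
    hdot G (phi alpha) beta = (-1) ^+ (d * k) * hdot G alpha (psi beta).

End Hermitian.

Section Smooth.
Variable R : realType.

Fixpoint Ck n (k : nat) (O : set 'rV[R]_n) (f : 'rV[R]_n -> R) : Prop :=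
  (forall x, O x -> {for x, continuous f}) /\
  if k is k'.+1 then
    forall i : 'I_n, (forall x, O x -> derivable f x (delta_mx 0 i)) /\
      Ck k' O (fun x => 'D_(delta_mx 0 i) f x)
  else True.

Definition smooth_on n (O : set 'rV[R]_n) (f : 'rV[R]_n -> R) : Prop :=
  forall k, Ck k O f.

Definition smooth_map_on n m (O : set 'rV[R]_n)
    (f : 'rV[R]_n -> 'rV[R]_m) : Prop :=
  forall j : 'I_m, smooth_on O (fun x => f x 0 j).

Lemma Ck_eq n k (O : set 'rV[R]_n) f g : open O ->
  (forall x, O x -> f x = g x) -> Ck k O f -> Ck k O g.
Proof.
move=> oO; elim: k f g => [|k IH] f g fg /= [fc fd].
  split=> // x Ox.
  have nfg : {near x, f =1 g} by apply: filterS (open_nbhs_nbhs (conj oO Ox)).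
  rewrite /prop_for /continuous_at -(fg x Ox).
  exact: cvg_trans (near_eq_cvg nfg) (fc _ Ox).
have nfg x : O x -> {near x, f =1 g}.
  by move=> Ox; apply: filterS (open_nbhs_nbhs (conj oO Ox)).
split=> [x Ox|i].
  rewrite /prop_for /continuous_at -(fg x Ox).
  exact: cvg_trans (near_eq_cvg (nfg _ Ox)) (fc _ Ox).
have [df cf] := fd i; split=> [x Ox|].
  exact: near_eq_derivable (nfg _ Ox) (df _ Ox).
by apply: IH cf => x Ox; exact: near_eq_derive (nfg _ Ox).
Qed.

Lemma Ck_cst n k (O : set 'rV[R]_n) (c : R) : open O -> Ck k O (cst c).
Proof.
move=> oO; have cc b x : O x -> {for x, continuous (cst b : 'rV[R]_n -> R)}.
  by move=> _; exact: (@cst_continuous _ _ b x).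
elim: k c => [|k IH] c /=; split; [exact: cc|by []|exact: cc|move=> i].
split; first by move=> x _; exact: derivable_cst.
by apply: Ck_eq (IH 0) => // x _; rewrite derive_cst.
Qed.

Lemma Ck_lin n k (O : set 'rV[R]_n) (a : R) f g : open O ->
  Ck k O f -> Ck k O g -> Ck k O (fun x => a * f x + g x).
Proof.
move=> oO; have cl (h l : 'rV[R]_n -> R) x : {for x, continuous h} ->
    {for x, continuous l} -> {for x, continuous (fun x => a * h x + l x)}.
  move=> hc lc; apply: (@continuousD _ _ _ (fun x => a * h x) l) => //.
  by apply: (@continuousM _ _ (cst a) h) => //; exact: (@cst_continuous _ _ a x).
elim: k f g => [|k IH] f g /= [fc fd] [gc gd].
  by split=> // x Ox; apply: cl; [exact: fc|exact: gc].
split=> [x Ox|i]; first by apply: cl; [exact: fc|exact: gc].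
have [df cf] := fd i; have [dg cg] := gd i; split=> [x Ox|].
  by apply: (@derivableD _ _ _ (a *: f) g); [apply: derivableZ; exact: df|exact: dg].
apply: Ck_eq (IH _ _ cf cg) => // x Ox; apply/esym.
rewrite (@deriveD _ _ _ (a *: f) g) ?deriveZ //; [exact: df | | exact: dg].
by apply: derivableZ; exact: df.
Qed.

End Smooth.

(* An oriented smooth atlas.  The tangent and cotangent spaces at p are
   identified with R^n through the chart [chart_at p], so that a (not
   necessarily continuous) differential form is a function X -> ext K n. *)
Record oriented_atlas (R : realType) (n : nat) (X : topologicalType) := {
  chart : Type;
  chart_dom : chart -> set X;
  chart_map : chart -> X -> 'rV[R]_n;
  chart_inv : chart -> 'rV[R]_n -> X;
  chart_at : X -> chart;
  chart_at_dom : forall p, chart_dom (chart_at p) p;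
  chart_dom_open : forall i, open (chart_dom i);
  chart_im_open : forall i, open (chart_map i @` chart_dom i);
  chart_mapK : forall i p, chart_dom i p -> chart_inv i (chart_map i p) = p;
  chart_map_continuous : forall i p, chart_dom i p ->
    {for p, continuous (chart_map i)};
  chart_inv_continuous : forall i x, (chart_map i @` chart_dom i) x ->
    {for x, continuous (chart_inv i)};
  chart_trans_smooth : forall i j,
    smooth_map_on (chart_map i @` (chart_dom i `&` chart_dom j))
      (chart_map j \o chart_inv i);
  chart_trans_oriented : forall i j p, chart_dom i p -> chart_dom j p ->
    0 < \det (jacobian (chart_map j \o chart_inv i) (chart_map i p))
}.

Section Manifold.
Variables (R : realType) (n : nat) (X : topologicalType).
Variable M : oriented_atlas R n X.
Implicit Types (i : chart M) (x : 'rV[R]_n) (p : X).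

Definition chart_im i : set 'rV[R]_n := chart_map i @` chart_dom i.

(* Tangent vectors at the point p of coordinates x in the chart i: if u is such
   a vector in the coordinates i, then u *m tangent_trans i x is the same
   vector in the coordinates [chart_at p].  Covectors go in the opposite
   direction through the transpose. *)
Definition tangent_trans i x : 'M[R]_n :=
  jacobian (chart_map (chart_at M (chart_inv i x)) \o chart_inv i) x.

Definition loc_form (alpha : X -> ext R n) i x : ext R n :=
  extmap (tangent_trans i x)^T (alpha (chart_inv i x)).

Definition loc_cform (alpha : X -> ext R[i] n) i x : ext R[i] n :=
  extmap (map_mx (real_complex R) (tangent_trans i x)^T)
    (alpha (chart_inv i x)).

Definition smooth_form (alpha : X -> ext R n) : Prop :=
  forall i I, smooth_on (chart_im i) (fun x => loc_form alpha i x I).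

Definition smooth_cform (alpha : X -> ext R[i] n) : Prop :=
  forall i I,
    smooth_on (chart_im i) (fun x => complex.Re (loc_cform alpha i x I)) /\
    smooth_on (chart_im i) (fun x => complex.Im (loc_cform alpha i x I)).

(* Exterior derivative in coordinates: sum_l dx_l /\ (d alpha / d x_l). *)
Definition loc_dext (alpha : 'rV[R]_n -> ext R n) x : ext R n :=
  \sum_(l < n) wedge (evec (delta_mx 0 l))
    [ffun I => 'D_(delta_mx 0 l) (fun y => alpha y I) x].

Definition closed_form (alpha : X -> ext R n) : Prop :=
  forall i x, chart_im i x -> loc_dext (loc_form alpha i) x = 0.

Definition riemannian_metric (g : X -> 'M[R]_n) : Prop :=
  [/\ forall p, (g p)^T = g p,
      forall p (u : 'rV[R]_n), u != 0 -> 0 < (u *m g p *m u^T) 0 0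
    & forall i a b, smooth_on (chart_im i) (fun x =>
        (tangent_trans i x *m g (chart_inv i x) *m (tangent_trans i x)^T) a b)].

(* A rank k distribution is integrable when an integral manifold passes through
   every point p; f is a parametrization of it near p, in the chart at p. *)
Definition integrable_distribution (k : nat) (E : X -> set 'rV[R]_n) : Prop :=
  forall p, let i := chart_at M p in
  exists (O : set 'rV[R]_k) (f : 'rV[R]_k -> 'rV[R]_n),
    [/\ open O /\ O 0,
        smooth_map_on O f,
        f 0 = chart_map i p,
        f @` O `<=` chart_im i
      & forall x : 'rV[R]_k, O x -> row_free (jacobian f x) /\
          forall u : 'rV[R]_n, (u <= jacobian f x)%MS <->
            E (chart_inv i (f x)) (u *m tangent_trans i (f x))].

Definition smooth_cform_pred : {pred X -> ext R[i] n} :=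
  fun alpha => `[< smooth_cform alpha >].

Lemma loc_cform_lin a alpha beta i x I :
  loc_cform (a *: alpha + beta) i x I =
  a * loc_cform alpha i x I + loc_cform beta i x I.
Proof.
rewrite /loc_cform /extmap !sum_ffunE mulr_sumr -big_split /=.
by apply: eq_bigr => J _; rewrite !ffunE /GRing.scale /= mulrDl mulrA.
Qed.

Lemma smooth_cform_submod_closed : submod_closed smooth_cform_pred.
Proof.
split.
  apply/asboolP => i I.
  have E x : loc_cform 0 i x I = 0.
    have := loc_cform_lin (-1) 0 0 i x I.
    by rewrite scaler0 addr0 mulN1r addNr.
  split=> k; apply: Ck_eq (Ck_cst _ 0 _) => //; try exact: chart_im_open;
    by move=> x _; rewrite E.
move=> a alpha beta /asboolP ha /asboolP hb; apply/asboolP => i I.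
have [ha1 ha2] := ha i I; have [hb1 hb2] := hb i I.
have oi : open (chart_im i) := @chart_im_open _ _ _ M i.
split=> k.
  apply: Ck_eq (Ck_lin (complex.Re a) oi (ha1 k)
    (Ck_lin (- complex.Im a) oi (ha2 k) (hb1 k))) => // x _.
  rewrite loc_cform_lin; case: a (loc_cform alpha i x I) (loc_cform beta i x I).
  by move=> a1 a2 [u1 u2] [w1 w2] /=; rewrite mulNr addrA.
apply: Ck_eq (Ck_lin (complex.Re a) oi (ha2 k)
  (Ck_lin (complex.Im a) oi (ha1 k) (hb2 k))) => // x _.
rewrite loc_cform_lin; case: a (loc_cform alpha i x I) (loc_cform beta i x I).
by move=> a1 a2 [u1 u2] [w1 w2] /=; rewrite addrA.
Qed.

HB.instance Definition _ := GRing.isSubmodClosed.Build _ _ smooth_cform_pred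
  smooth_cform_submod_closed.

(* The space Omega^*_C(X) of smooth complex forms. *)
Record cforms := CForm {
  cform_val :> X -> ext R[i] n;
  cform_smooth : cform_val \in smooth_cform_pred }.

HB.instance Definition _ := [isSub for cform_val].
HB.instance Definition _ := [Choice of cforms by <:].
HB.instance Definition _ := [SubChoice_isSubLmodule of cforms by <:].

Definition cform_parity (b : bool) : set cforms :=
  [set alpha : cforms | forall p (I : {set 'I_n}), alpha p I != 0 -> odd #|I| = b].

End Manifold.

Section LieSuperalgebra.
Variables (R : realType) (V : lmodType R[i]) (parity : bool -> set V).

Definition op_parity (b : bool) (D : V -> V) : Prop :=
  forall c v, parity c v -> parity (b (+) c) (D v).

(* For a set G of homogeneous operators, the generated algebra is spanned over
   the reals by iterated brackets of homogeneous elements, so brackets of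
   homogeneous elements are enough. *)
Inductive lie_generated (G : set (V -> V)) : (V -> V) -> Prop :=
| lie_gen D : G D -> lie_generated G D
| lie_zero : lie_generated G 0
| lie_add D E :
    lie_generated G D -> lie_generated G E -> lie_generated G (D + E)
| lie_scale (r : R) D : lie_generated G D -> lie_generated G (r%:C *: D)
| lie_bracket a b D E :
    lie_generated G D -> lie_generated G E ->
    op_parity a D -> op_parity b E ->
    lie_generated G (D \o E - (-1) ^+ (a && b) *: (E \o D)).

End LieSuperalgebra.

(* v i j stands for v_{i+1,j}. *)
Definition coframe (R : realType) := 'I_3 -> 'I_3 -> 'rV[R]_9.

(* The rows are v_{10}, v_{20}, v_{30}, v_{11}, ..., v_{32}. *)
Definition coframe_mx (R : realType) (v : coframe R) : 'M[R]_9 :=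
  \matrix_(k < 9) v (inord (k %% 3)) (inord (k %/ 3)).

Definition pair_form (R : realType) (v : coframe R) (j j' : 'I_3) : ext R 9 :=
  \sum_(i < 3) wedge (evec (v i j)) (evec (v i j')).

Definition adapted_coframe (R : realType) (g : 'M[R]_9) (w1 w2 wD : ext R 9)
    (v : coframe R) : Prop :=
  [/\ forall i j i' j', (v i j *m invmx g *m (v i' j')^T) 0 0
        = ((i == i') && (j == j'))%:R,
      w1 = pair_form v (inord 0) (inord 1),
      w2 = pair_form v (inord 0) (inord 2)
    & wD = pair_form v (inord 1) (inord 2)].

(* Oriented rank three nondegenerate WSD manifolds.  The metric is given on
   tangent vectors, so that invmx (metric p) is the metric on covectors.  In the
   presence of adapted coframes, omega_1^0 + omega_2^0 has rank 6. *)
Record wsd_manifold (R : realType) (X : topologicalType) := {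
  wsd_atlas :> oriented_atlas R 9 X;
  wsd_hausdorff : hausdorff_space X;
  wsd_second_countable : @second_countable X;
  metric : X -> 'M[R]_9;
  metricP : riemannian_metric wsd_atlas metric;
  omega1 : X -> ext R 9;
  omega2 : X -> ext R 9;
  omegaD : X -> ext R 9;
  omega_homog : forall p,
    [/\ homog 2 (omega1 p), homog 2 (omega2 p) & homog 2 (omegaD p)];
  omega_smooth : [/\ smooth_form wsd_atlas omega1,
    smooth_form wsd_atlas omega2 & smooth_form wsd_atlas omegaD];
  omega_closed : [/\ closed_form wsd_atlas omega1,
    closed_form wsd_atlas omega2 & closed_form wsd_atlas omegaD];
  wsd_integrable : integrable_distribution wsd_atlas 6 (fun p =>
    [set u + w | u in form_kernel (omega1 p) & w in form_kernel (omega2 p)]);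
  wsd_coframe : forall p, exists v,
    adapted_coframe (metric p) (omega1 p) (omega2 p) (omegaD p) v
}.

Section WSD.
Variables (R : realType) (X : topologicalType) (W : wsd_manifold R X).
Implicit Types (p : X) (j : 'I_3).

(* Adapted coframes at p with (v_{1j}, v_{2j}, v_{3j}) oriented; charts being
   oriented, this is the positivity of a determinant. *)
Definition oriented_coframe p (v : coframe R) : Prop :=
  adapted_coframe (metric W p) (omega1 W p) (omega2 W p) (omegaD W p) v /\
  0 < \det (coframe_mx v).

(* L_j is the exterior product by Lform p j; note the sign in L_1. *)
Definition Lform p j : ext R 9 :=
  if val j is 0 then omegaD W p
  else if val j is 1 then - omega2 W p
  else omega1 W p.

Definition coframe_vol (v : coframe R) j : ext R 9 :=
  wedge (evec (v (inord 0) j))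
    (wedge (evec (v (inord 1) j)) (evec (v (inord 2) j))).

(* eta = Vol(W_j), which does not depend on the oriented adapted coframe. *)
Definition is_vol p j (eta : ext R 9) : Prop :=
  exists2 v, oriented_coframe p v & eta = coframe_vol v j.

Definition wedge_op (eta : ext R 9) (x : ext R[i] 9) : ext R[i] 9 :=
  wedge (complexify eta) x.

Definition fibrewise (T : X -> ext R[i] 9 -> ext R[i] 9)
    (D : cforms W -> cforms W) : Prop :=
  forall (alpha : cforms W) p, D alpha p = T p (alpha p).

Definition is_star (d : nat) (phi : X -> ext R[i] 9 -> ext R[i] 9)
    (psi : X -> {linear ext R[i] 9 -> ext R[i] 9}) : Prop :=
  forall p, superadjoint (invmx (metric W p)) d (phi p) (psi p).

Inductive wsd_generator : (cforms W -> cforms W) -> Prop :=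
| gen_iL j D :
    fibrewise (fun p x => 'i *: wedge_op (Lform p j) x) D ->
    wsd_generator D
| gen_iV j eta D : (forall p, is_vol p j (eta p)) ->
    fibrewise (fun p x => 'i *: wedge_op (eta p) x) D ->
    wsd_generator D
| gen_iLambda j psi D : is_star 2 (fun p => wedge_op (Lform p j)) psi ->
    fibrewise (fun p x => 'i *: psi p x) D ->
    wsd_generator D
| gen_A j eta psi D : (forall p, is_vol p j (eta p)) ->
    is_star 3 (fun p => wedge_op (eta p)) psi ->
    fibrewise psi D ->
    wsd_generator D.

Definition L3 : (cforms W -> cforms W) -> Prop :=
  lie_generated (@cform_parity R 9 X W) wsd_generator.

End WSD.

Definition SO3 (R : realType) (g : 'M[R]_3) : Prop :=
  g *m g^T = 1%:M /\ \det g = 1.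

(* Matrix, acting on the right of covectors, of the linear map sending v_{ij}
   to sum_k g_{ki} v_{kj}. *)
Definition so3_mx (R : realType) (v : coframe R) (g : 'M[R]_3) : 'M[R]_9 :=
  invmx (coframe_mx v) *m
    coframe_mx (fun i j => \sum_(k < 3) g k i *: v k j).

Definition so3_act (R : realType) (v : coframe R) (g : 'M[R]_3)
    (x : ext R[i] 9) : ext R[i] 9 :=
  extmap (map_mx (real_complex R) (so3_mx v g)) x.

(* Main.v *)
Require Import Defs.
From mathcomp Require Import all_boot all_order all_algebra.
From mathcomp Require Import all_classical all_reals all_analysis.
From mathcomp Require Import complex.
From HB Require Import structures.
From mathcomp Require Import finset.

Set Implicit Arguments.
Unset Strict Implicit.
Unset Printing Implicit Defensive.

Import Order.TTheory GRing.Theory Num.Theory.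
Import numFieldNormedType.Exports.

Local Open Scope ring_scope.
Local Open Scope complex_scope.

(** The generators are wedge products by the forms L_j and Vol(W_j) and the
    superadjoints of these wedge products.  The forms are SO(3)-invariant, and
    SO(3) acts by isometries, so everything commutes with the action; sums,
    real multiples and brackets of commuting operators commute as well.

    - The action is induced by a linear map, hence multiplicative for the wedge
      product ([extmap_wedge]).  So wedging by an invariant form commutes with
      it.  The forms sum_i v_ij /\ v_ij' are invariant because g is orthogonal
      ([pair_form_rotate]), and v_1j /\ v_2j /\ v_3j because det g = 1
      ([coframe_vol_rotate]).

    - Rotating an orthonormal coframe gives an orthonormal coframe, so the
      action on covectors is an isometry ([so3_mx_isometry]).  The induced
      Hermitean product is a product of Gram determinants; since the matrix of
      an induced map consists of minors ([extmap_basis_minor]), it equals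
      sum_J (extmap G x)_J conj(y_J) ([hdotE]), and invariance becomes
      functoriality of the induced map, i.e. the Cauchy-Binet formula
      ([hdot_isometry]).  As the product is nondegenerate, the superadjoint of
      an operator that commutes with an isometry commutes with it too
      ([superadjoint_commute]).

    - The volume forms in the generators may come from other coframes than the
      one that defines the action.  They agree: in two adapted coframes the
      three 2-forms, turned into endomorphisms by the metric, are the same, so
      the kernel W_0 of the endomorphism of omega_D is common, and those of
      omega_1 and omega_2 carry W_0 to W_1 and W_2.  Thus one 3 x 3 orthogonal
      matrix b compares the coframes on all three W_j; orientedness gives
      (det b)^3 > 0, hence det b = 1 ([oriented_coframe_vol]). *)

(** * The wedge product *)

Section WedgeProduct.
Variables (K : comNzRingType) (n : nat).
Implicit Types (x y z : ext K n) (I J L : {set 'I_n}) (u w : 'rV[K]_n).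
Local Notation e := (@ext_basis K n).

(** As a double product the sign is visibly multiplicative in disjoint unions of
    either argument, which is what associativity of the wedge product needs. *)
Lemma ext_signE I J :
  ext_sign K I J = \prod_(i in I) \prod_(j in J) (-1) ^+ (j < i)%N.
Proof.
rewrite /ext_sign -sum1_card; under eq_bigl do rewrite inE.
rewrite big_mkcondr /= -prodrXr pair_big_dep /=.
apply: eq_big => [[i j]|[i j] _] /=; first by rewrite in_setX.
by rewrite /=; case: ifP.
Qed.

Let prod_setU I J (F : 'I_n -> K) : [disjoint I & J] ->
  \prod_(i in I :|: J) F i = (\prod_(i in I) F i) * \prod_(i in J) F i.
Proof. by move=> dIJ; rewrite -bigU //; apply: eq_bigl => i; rewrite !inE. Qed.

Lemma ext_sign_Ul I J L : [disjoint I & J] ->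
  ext_sign K (I :|: J) L = ext_sign K I L * ext_sign K J L.
Proof. by move=> dIJ; rewrite !ext_signE prod_setU. Qed.

Lemma ext_sign_Ur I J L : [disjoint J & L] ->
  ext_sign K I (J :|: L) = ext_sign K I J * ext_sign K I L.
Proof.
by move=> dJL; rewrite !ext_signE -big_split; apply: eq_bigr => i _; rewrite prod_setU.
Qed.

Lemma ext_basisE x : x = \sum_I x I *: e I.
Proof.
apply/ffunP => I; rewrite sum_ffunE (bigD1 I) //= !ffunE eqxx.
rewrite big1 => [|J /negPf nJI]; last by rewrite !ffunE eq_sym nJI; exact: mulr0.
by rewrite addr0 [RHS]mulr1.
Qed.

Lemma ext_lin_eq (V : lmodType K) (f g : {linear ext K n -> V}) :
  (forall I, f (e I) = g (e I)) -> f =1 g.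
Proof.
move=> fg x; rewrite [x]ext_basisE !linear_sum; apply: eq_bigr => I _.
by rewrite !linearZ /= fg.
Qed.

Fact wedge_is_linear x : linear (wedge x).
Proof.
move=> a y z; apply/ffunP => I; rewrite !ffunE scaler_sumr -big_split /=.
apply: eq_bigr => J _; rewrite !ffunE mulrDr; congr (_ + _).
by rewrite /GRing.scale /= mulrCA.
Qed.

HB.instance Definition _ x :=
  GRing.isLinear.Build K (ext K n) (ext K n) _ (wedge x) (wedge_is_linear x).

(** A flipped copy of [wedge], which carries linearity in the first argument. *)
Definition wedger y x := wedge x y.

Fact wedger_is_linear y : linear (wedger y).
Proof.
move=> a x z; apply/ffunP => I; rewrite !ffunE scaler_sumr -big_split /=.
apply: eq_bigr => J _; rewrite !ffunE mulrDr mulrDl; congr (_ + _).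
by rewrite /GRing.scale /= !mulrA (mulrC a).
Qed.

HB.instance Definition _ y :=
  GRing.isLinear.Build K (ext K n) (ext K n) _ (wedger y) (wedger_is_linear y).

Lemma wedgeDl x y z : wedge (x + y) z = wedge x z + wedge y z.
Proof. exact: (linearD (wedger z)). Qed.

Lemma wedgeZl a x z : wedge (a *: x) z = a *: wedge x z.
Proof. exact: (linearZ_LR (wedger z)). Qed.

Lemma wedge0l z : wedge 0 z = 0.
Proof. exact: (linear0 (wedger z)). Qed.

Lemma wedge_suml T (r : seq T) (P : pred T) (F : T -> ext K n) z :
  wedge (\sum_(i <- r | P i) F i) z = \sum_(i <- r | P i) wedge (F i) z.
Proof. exact: (linear_sum (wedger z)). Qed.

Lemma wedge_basis I J :
  wedge (e I) (e J) =
  if [disjoint I & J] then ext_sign K I J *: e (I :|: J) else 0.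
Proof.
apply/ffunP => L; rewrite ffunE big_mkcond (bigD1 I) //= big1 ?addr0; last first.
  move=> I' /negPf nI; case: ifP => // _.
  by rewrite !ffunE nI mulr0 mul0r.
rewrite !ffunE eqxx mulr1; case: ifP => sIL; last first.
  case: ifP => d; rewrite !ffunE //.
  case: eqP => [EL|_]; last by rewrite [RHS]mulr0.
  by rewrite EL finset.subsetUl in sIL.
case: (L :\: I =P J) => [<-|nJ].
  rewrite mulr1 disjoint_sym -setI_eq0 setIDAC setDIl setDv setI0 eqxx !ffunE.
  by rewrite setUC setDE setUIl (setUC (~: I)) setUCr setIT (setUidPl sIL) eqxx [RHS]mulr1.
rewrite mulr0; case: ifP => d; rewrite !ffunE //.
case: eqP => [EL|_]; last by rewrite [RHS]mulr0.
case: nJ; rewrite EL setDUl setDv set0U; apply/setDidPl.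
by rewrite disjoint_sym.
Qed.

Lemma wedge1l x : wedge (ext1 K n) x = x.
Proof.
rewrite [x]ext_basisE linear_sum; apply: eq_bigr => I _.
rewrite linearZ /= wedge_basis -setI_eq0 set0I eqxx set0U.
by rewrite ext_signE big_set0 scale1r.
Qed.

Lemma wedge1r x : wedge x (ext1 K n) = x.
Proof.
rewrite {1}[x]ext_basisE wedge_suml [RHS]ext_basisE; apply: eq_bigr => I _.
rewrite wedgeZl wedge_basis -setI_eq0 setI0 eqxx setU0.
by rewrite ext_signE big1 ?scale1r // => i _; rewrite big_set0.
Qed.

(** On basis elements both sides are e_(I U J U L), with the product of the signs
    of the pairs (I,J), (I,L) and (J,L), or vanish when two of the sets meet. *)
Lemma wedgeA x y z : wedge x (wedge y z) = wedge (wedge x y) z.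
Proof.
rewrite [x]ext_basisE !wedge_suml; apply: eq_bigr => I _; rewrite !wedgeZl.
congr (_ *: _).
rewrite [y]ext_basisE wedge_suml !linear_sum wedge_suml; apply: eq_bigr => J _ /=.
rewrite !wedgeZl !linearZ /= !wedgeZl; congr (_ *: _).
rewrite [z]ext_basisE !linear_sum; apply: eq_bigr => L _ /=.
rewrite !linearZ /=; congr (_ *: _).
have dU (A B C : {set 'I_n}) :
    [disjoint A :|: B & C] = [disjoint A & C] && [disjoint B & C].
  by rewrite -!setI_eq0 setIUl setU_eq0.
have dU2 (A B C : {set 'I_n}) :
    [disjoint A & B :|: C] = [disjoint A & B] && [disjoint A & C].
  by rewrite -!setI_eq0 setIUr setU_eq0.
rewrite !wedge_basis.
have [dJL|ndJL] := boolP [disjoint J & L]; have [dIJ|ndIJ] := boolP [disjoint I & J].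
- rewrite wedgeZl linearZ /= !wedge_basis dU dU2 dIJ dJL andbT /=.
  case: ifP => dIL; last by rewrite !scaler0.
  rewrite ext_sign_Ul // ext_sign_Ur // !scalerA setUA; congr (_ *: _).
  by rewrite mulrC -mulrA.
- rewrite wedge0l linearZ /= wedge_basis dU2.
  by rewrite (negPf ndIJ) scaler0.
- by rewrite linear0 wedgeZl wedge_basis dU (negPf ndJL) andbF scaler0.
- by rewrite linear0 wedge0l.
Qed.

HB.instance Definition _ :=
  Monoid.isLaw.Build (ext K n) (ext1 K n) (@wedge K n) wedgeA wedge1l wedge1r.

Lemma evec_is_linear : linear (@evec K n).
Proof.
move=> a u w; rewrite /evec scaler_sumr -big_split /=; apply: eq_bigr => i _.
by rewrite !mxE scalerDl scalerA.
Qed.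

HB.instance Definition _ :=
  GRing.isLinear.Build K 'rV[K]_n (ext K n) _ (@evec K n) evec_is_linear.

Lemma evec_delta i : evec (delta_mx 0 i) = e [set i].
Proof.
rewrite /evec (bigD1 i) //= big1 ?addr0 => [|j /negPf nij].
  by rewrite mxE !eqxx scale1r.
by rewrite mxE nij andbF scale0r.
Qed.

Lemma evec_wedgeE u x I :
  wedge (evec u) x I =
  \sum_(i in I) u 0 i * (ext_sign K [set i] (I :\ i) * x (I :\ i)).
Proof.
rewrite /evec wedge_suml sum_ffunE [RHS]big_mkcond /=; apply: eq_bigr => i _.
rewrite wedgeZl !ffunE; case: ifP => iI.
  rewrite (bigD1 [set i]) ?sub1set //= big1 ?addr0 => [|J /andP[_ /negPf nJ]].
    by rewrite !ffunE eqxx mulr1.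
  by rewrite !ffunE nJ mulr0 mul0r.
rewrite big1 => [|J sJI]; first exact: mulr0.
rewrite !ffunE; case: eqP => [EJ|_]; last by rewrite mulr0 mul0r.
by rewrite EJ sub1set iI in sJI.
Qed.

Lemma evec_wedge_anti u w :
  wedge (evec u) (evec w) = - wedge (evec w) (evec u).
Proof.
have alt i j : wedge (e [set i]) (e [set j]) = - wedge (e [set j]) (e [set i]).
  rewrite !wedge_basis !disjoints1 !inE [j == i]eq_sym.
  case: eqP => [_|/eqP nij]; first by rewrite oppr0.
  rewrite setUC -scaleNr /=; congr (_ *: _).
  rewrite !ext_signE !big_set1; case: ltngtP => [||/val_inj E]; rewrite ?expr1 ?expr0 ?opprK //.
  by rewrite E eqxx in nij.
rewrite /evec !wedge_suml -sumrN.
under eq_bigr do rewrite linear_sum /=.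
rewrite exchange_big /=; apply: eq_bigr => j _.
rewrite linear_sum -sumrN; apply: eq_bigr => i _.
by rewrite !wedgeZl !linearZ /= alt !scalerN scalerA mulrC -scalerA !wedgeZl.
Qed.

(** Antisymmetry alone does not give this when 2 is not regular.  It makes
    u |-> u /\ u additive, so that the squares of multiples of basis vectors are
    enough. *)
Lemma evec_wedge_sqr u : wedge (evec u) (evec u) = 0.
Proof.
pose Q x := wedge x x = 0 /\ exists w, x = evec w.
suff [//] : Q (evec u).
rewrite {1}/evec; apply: big_ind => [|x y [sx [w xE]] [sy [w' yE]]|i _].
- by split; [exact: linear0 | exists 0; rewrite linear0].
- split; last by exists (w + w'); rewrite linearD xE yE.
  rewrite wedgeDl !linearD /= sx sy addr0 add0r xE yE.
  by rewrite evec_wedge_anti addNr.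
split; last by exists (u 0 i *: delta_mx 0 i); rewrite linearZ /= evec_delta.
by rewrite wedgeZl linearZ /= wedge_basis disjoints1 inE eqxx !scaler0.
Qed.

(** The products over a set of indices that define induced maps, and the rows and
    columns of Gram minors, both follow the increasing enumeration of the set. *)
Lemma sorted_enum_set I : sorted (fun i j : 'I_n => i < j)%N (enum I).
Proof.
suff: sorted ltn (map val (enum I)) by rewrite sorted_map.
rewrite -[enum _](eq_filter (mem_enum _)).
rewrite -(eq_filter (mem_map val_inj _)) -filter_map.
by rewrite (sorted_filter ltn_trans) // unlock val_ord_enum iota_ltn_sorted.
Qed.

Lemma enum_set_min (i : 'I_n) I : i \in I -> {in I, forall j : 'I_n, i <= j}%N ->
  enum I = i :: enum (I :\ i).
Proof.
move=> iI mi; apply: (@irr_sorted_eq _ (fun i j : 'I_n => i < j)%N).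
- by move=> j k l; apply: ltn_trans.
- by move=> j; rewrite /= ltnn.
- exact: sorted_enum_set.
- rewrite /= path_min_sorted ?sorted_enum_set //.
  apply/allP => j; rewrite mem_enum !inE => /andP[nji jI].
  by rewrite ltn_neqAle mi // andbT eq_sym.
by move=> j; rewrite inE !mem_enum !inE; case: eqP => // ->.
Qed.

(** The wedge product does not commute, so this depends on the two enumerations
    having the same order. *)
Lemma big_wedge_enum (F : 'I_n -> ext K n) I :
  \big[@wedge K n/ext1 K n]_(i in I) F i =
  \big[@wedge K n/ext1 K n]_(i <- enum I) F i.
Proof. by rewrite -big_filter [index_enum _]unlock. Qed.

Lemma big_wedge_min (F : 'I_n -> ext K n) (i : 'I_n) I :
  i \in I -> {in I, forall j : 'I_n, i <= j}%N ->
  \big[@wedge K n/ext1 K n]_(j in I) F j =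
  wedge (F i) (\big[@wedge K n/ext1 K n]_(j in I :\ i) F j).
Proof.
by move=> iI mi; rewrite !big_wedge_enum (enum_set_min iI mi) big_cons.
Qed.

Lemma ext_basis_min (i : 'I_n) I :
  i \in I -> {in I, forall j : 'I_n, i <= j}%N ->
  e I = wedge (e [set i]) (e (I :\ i)).
Proof.
move=> iI mi; rewrite wedge_basis disjoints1 !inE eqxx /= setD1K // ext_signE.
rewrite big_set1 big1 ?scale1r // => j; rewrite !inE => /andP[_ /mi].
by rewrite leqNgt => /negPf ->.
Qed.

Lemma set_minP I : I != set0 ->
  exists2 i : 'I_n, i \in I & {in I, forall j : 'I_n, i <= j}%N.
Proof.
by case/set0Pn => i0 i0I; case: (arg_minnP (fun i : 'I_n => i : nat) i0I) => i; exists i.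
Qed.

(** Forms are generated from 1 by wedging with vectors on the left: e_I is e_i
    wedged with the rest, i being the least element of I. *)
Lemma ext_ind (P : ext K n -> Prop) :
  (forall a x y, P x -> P y -> P (a *: x + y)) -> P (ext1 K n) ->
  (forall u x, P x -> P (wedge (evec u) x)) -> forall x, P x.
Proof.
move=> Plin P1 PM x; have P0 : P 0.
  by have := Plin (-1) _ _ P1 P1; rewrite scaleN1r addNr.
rewrite [x]ext_basisE; elim/big_ind: _ => // [y z Py Pz|I _].
  by have := Plin 1 _ _ Py Pz; rewrite scale1r.
rewrite -[_ *: _]addr0; apply: Plin => //.
elim: {I}_.+1 {-2}I (ltnSn #|I|) => // k IHk I; rewrite ltnS => leIk.
have [->//|/set_minP[i iI mi]] := eqVneq I set0.
rewrite (ext_basis_min iI mi) -evec_delta; apply/PM/IHk.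
by rewrite (cardsD1 i) iI in leIk.
Qed.

End WedgeProduct.

(** * Maps induced on forms by linear maps *)

Section InducedMap.
Variables (K : comNzRingType) (n : nat).
Implicit Types (x y z : ext K n) (I J L : {set 'I_n}) (u w : 'rV[K]_n) (A B : 'M[K]_n).
Local Notation e := (@ext_basis K n).

Fact extmap_is_linear A : linear (extmap A).
Proof.
move=> a x y; rewrite /extmap scaler_sumr -big_split /=; apply: eq_bigr => I _.
by rewrite !ffunE scalerDl scalerA.
Qed.

HB.instance Definition _ A :=
  GRing.isLinear.Build K (ext K n) (ext K n) _ (extmap A) (extmap_is_linear A).

Lemma extmap_basis A I :
  extmap A (e I) = \big[@wedge K n/ext1 K n]_(i in I) evec (row i A).
Proof.
rewrite /extmap (bigD1 I) //= [X in _ + X]big1 ?addr0 => [|J /negPf nJI].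
  by rewrite !ffunE eqxx scale1r.
by rewrite !ffunE nJI scale0r.
Qed.

Lemma extmap1 A : extmap A (ext1 K n) = ext1 K n.
Proof. by rewrite extmap_basis big_set0. Qed.

(** When i precedes I, both sides are the same ordered product. *)
Let extmap_min A (i : 'I_n) I : {in I, forall j : 'I_n, i < j}%N ->
  extmap A (wedge (e [set i]) (e I)) = wedge (evec (row i A)) (extmap A (e I)).
Proof.
move=> mi; have niI : i \notin I by apply/negP => /mi; rewrite ltnn.
have iI : i \in i |: I by rewrite setU11.
have mi' : {in i |: I, forall j : 'I_n, i <= j}%N.
  by move=> j; rewrite !inE => /predU1P[->//|/mi/ltnW].
have -> : I = (i |: I) :\ i by rewrite setU1K.
by rewrite -ext_basis_min // !extmap_basis (big_wedge_min _ iI mi').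
Qed.

(** By linearity only e_i /\ e_I matters.  If the least element m of I is smaller
    than i, then e_i and e_m anticommute and the induction hypothesis applies to
    e_i /\ e_(I \ m), a multiple of a basis element whose indices all exceed m;
    in this way no sign has to be computed. *)
Lemma extmap_evec_wedge A u x :
  extmap A (wedge (evec u) x) = wedge (evec (u *m A)) (extmap A x).
Proof.
suff H i I : extmap A (wedge (e [set i]) (e I)) =
    wedge (evec (row i A)) (extmap A (e I)).
  apply: (ext_lin_eq (f := extmap A \o wedge (evec u))
                     (g := wedge (evec (u *m A)) \o extmap A)) => I /=.
  rewrite [u]row_sum_delta mulmx_suml !(linear_sum (@evec K n)) !wedge_suml.
  rewrite (linear_sum (extmap A)); apply: eq_bigr => i _.
  rewrite -scalemxAl !(linearZ_LR (@evec K n)) !wedgeZl (linearZ_LR (extmap A)).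
  by congr (_ *: _); rewrite /= evec_delta H -rowE.
elim: {I}_.+1 i {-2}I (ltnSn #|I|) => // k IHk i I; rewrite ltnS => leIk.
have [->|/set_minP[m mI mm]] := eqVneq I set0.
  by apply: extmap_min => j; rewrite inE.
have [ltim|ltmi|/val_inj->] := ltngtP i m.
- by apply: extmap_min => j /mm; apply: leq_trans.
- (* m < i: move e_m, and row m of A, to the front. *)
  rewrite (ext_basis_min _ mI mm); set I' := I :\ m.
  have mI' : {in I', forall j : 'I_n, m < j}%N.
    move=> j; rewrite !inE => /andP[njm /mm].
    by rewrite leq_eqVlt eq_sym => /predU1P[/val_inj E|//]; rewrite E eqxx in njm.
  have leI'k : (#|I'| < k)%N by rewrite (cardsD1 m) mI in leIk.
  rewrite (extmap_min _ mI') wedgeA -!evec_delta [in LHS]evec_wedge_anti.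
  rewrite -scaleN1r wedgeZl linearZ /= -wedgeA !evec_delta.
  rewrite [in RHS]wedgeA [in RHS]evec_wedge_anti -scaleN1r wedgeZl -wedgeA -IHk //.
  congr (_ *: _); rewrite [wedge (e [set i]) _]wedge_basis; case: ifP => _; last first.
    by rewrite !linear0.
  rewrite !linearZ /= extmap_min // => j; rewrite in_setU1 => /predU1P[->//|].
  exact: mI'.
(* i = m: both sides contain a square. *)
rewrite (ext_basis_min _ mI mm) wedgeA -evec_delta evec_wedge_sqr.
rewrite wedge0l linear0 evec_delta -ext_basis_min // extmap_basis.
by rewrite (big_wedge_min _ mI mm) wedgeA evec_wedge_sqr wedge0l.
Qed.

Lemma extmap_wedge A x y : extmap A (wedge x y) = wedge (extmap A x) (extmap A y).
Proof.
elim/ext_ind: x => [a x z IHx IHz||u x IHx].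
- by rewrite wedgeDl wedgeZl !linearP /= IHx IHz -wedgeZl -wedgeDl.
- by rewrite extmap1 !wedge1l.
by rewrite -wedgeA !extmap_evec_wedge IHx wedgeA.
Qed.

Lemma extmap_evec A u : extmap A (evec u) = evec (u *m A).
Proof. by rewrite -[evec u]wedge1r extmap_evec_wedge extmap1 wedge1r. Qed.

Lemma extmap_comp A B x : extmap A (extmap B x) = extmap (B *m A) x.
Proof.
elim/ext_ind: x => [a x z IHx IHz||u x IHx]; first by rewrite !linearP /= IHx IHz.
  by rewrite !extmap1.
by rewrite !extmap_evec_wedge IHx mulmxA.
Qed.

Lemma extmap_id x : extmap 1%:M x = x.
Proof.
elim/ext_ind: x => [a x z IHx IHz||u x IHx]; first by rewrite !linearP /= IHx IHz.
  by rewrite extmap1.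
by rewrite extmap_evec_wedge IHx mulmx1.
Qed.

End InducedMap.

(** * Coefficients of induced maps are minors *)

Section Minors.
Variables (K : comNzRingType) (n : nat).
Implicit Types (x y z : ext K n) (I J L : {set 'I_n}) (u w : 'rV[K]_n) (A B : 'M[K]_n).
Local Notation e := (@ext_basis K n).

Lemma ltn_nth_enum J d (b c : nat) : (b < #|J|)%N -> (c < #|J|)%N ->
  (nth d (enum J) b < nth d (enum J) c)%N = (b < c)%N.
Proof.
rewrite cardE => ltb ltc; have tr : transitive (fun i j : 'I_n => i < j)%N.
  by move=> ? ? ?; apply: ltn_trans.
have mono := sorted_ltn_nth tr d (sorted_enum_set J).
have [ltbc|ltcb|->] := ltngtP b c; last by rewrite ltnn.
  exact: mono.
by apply/negbTE; rewrite -leqNgt ltnW // mono.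
Qed.

Lemma sum_nth_enum (V : nmodType) (F : 'I_n -> V) J d k : #|J| = k ->
  \sum_(i in J) F i = \sum_(b < k) F (nth d (enum J) b).
Proof. by move=> <-; rewrite -big_enum (big_nth d) -cardE big_mkord. Qed.

(** Exactly the first b elements of J are smaller than the b-th one; this is the
    sign in the Laplace expansion along the first row. *)
Lemma ext_sign_nth J d b : (b < #|J|)%N ->
  ext_sign K [set nth d (enum J) b] (J :\ nth d (enum J) b) = (-1) ^+ b.
Proof.
move=> ltb; set j := nth _ _ _.
have jJ : j \in J by rewrite -mem_enum mem_nth -?cardE.
rewrite ext_signE big_set1 prodrXr; congr (_ ^+ _).
have -> : (\sum_(i in J :\ j) (i < j)%N = \sum_(i in J) (i < j)%N)%N.
  by rewrite [RHS](big_setD1 j) //= ltnn.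
rewrite (sum_nth_enum _ d (erefl #|J|)).
under eq_bigr => c _ do rewrite ltn_nth_enum //.
rewrite (eq_bigr (fun c : 'I__ => if (c < b)%N then 1%N else 0%N)) => [|c _]; last by case: ltnP.
by rewrite -big_mkcond (big_ord_narrow (ltnW ltb)) sum1_card card_ord.
Qed.

Lemma nth_enum_setD1 J d b c : (b < #|J|)%N -> (c < #|J|.-1)%N ->
  nth d (enum (J :\ nth d (enum J) b)) c = nth d (enum J) (bump b c).
Proof.
move=> ltb ltc; set j := nth d (enum J) b.
have -> : enum (J :\ j) = rem j (enum J).
  rewrite rem_filter ?enum_uniq //.
  have tr : transitive (fun i j : 'I_n => i < j)%N by move=> ? ? ?; apply: ltn_trans.
  apply: (irr_sorted_eq tr); rewrite ?sorted_enum_set //.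
  - by move=> i /=; rewrite ltnn.
  - by apply: sorted_filter => //; exact: sorted_enum_set.
  by move=> i; rewrite mem_enum (mem_filter (predC1 j)) mem_enum !inE.
rewrite remE index_uniq ?enum_uniq -?cardE // nth_cat size_takel -?cardE ?(ltnW ltb) //.
rewrite /bump; case: ltnP => [ltcb|lebc].
  by rewrite nth_take.
by rewrite nth_drop addSn subnKC.
Qed.

(** Peeling off the first vector on the left and expanding the determinant along
    its first row are the same recursion.  The defaults d are never reached; they
    are a family because there is no index to choose when k = 0. *)
Lemma wedge_evecs_coef k (u : 'I_k -> 'rV[K]_n) J (d : 'I_k -> 'I_n) :
  (\big[@wedge K n/ext1 K n]_(a < k) evec (u a)) J =
  if #|J| == k then \det (\matrix_(a, b) u a 0 (nth (d a) (enum J) b)) else 0.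
Proof.
elim: k u J d => [|k IHk] u J d.
  by rewrite big_ord0 ffunE cards_eq0 det_mx00; case: eqP.
rewrite big_ord_recl evec_wedgeE.
under eq_bigr => j jJ do rewrite (IHk _ _ (fun a => d (lift ord0 a))).
case: eqP => [Jk|nJk]; last first.
  rewrite big1 // => j jJ; case: eqP => [E|]; last by rewrite !mulr0.
  by case: nJk; rewrite (cardsD1 j) jJ E.
rewrite (sum_nth_enum _ (d ord0) Jk) (expand_det_row _ ord0).
apply: eq_bigr => b _; rewrite !mxE; congr (_ * _).
have ltb : (b < #|J|)%N by rewrite Jk.
set j := nth _ _ _; have jJ : j \in J by rewrite -mem_enum mem_nth -?cardE.
have -> : #|J :\ j| == k by move: Jk; rewrite (cardsD1 j) jJ add1n => -[->].
rewrite ext_sign_nth // /cofactor add0n; congr (_ * \det _).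
apply/matrixP => a c; rewrite !mxE; congr (u _ _ _).
rewrite (set_nth_default (d ord0)).
  rewrite nth_enum_setD1 // ?Jk // ; apply: set_nth_default.
  by rewrite -cardE Jk /= (ltn_ord (lift b c)).
by rewrite -cardE; move: Jk; rewrite (cardsD1 j) jJ add1n => -[->].
Qed.

Lemma extmap_basis_ord A I k (d : 'I_k -> 'I_n) : #|I| = k ->
  extmap A (e I) =
  \big[@wedge K n/ext1 K n]_(a < k) evec (row (nth (d a) (enum I) a) A).
Proof.
rewrite extmap_basis big_wedge_enum cardE; case: k d => [|k] d Ik.
  by rewrite (size0nil Ik) big_nil big_ord0.
rewrite (big_nth (d ord0)) Ik big_mkord; apply: eq_bigr => a _.
by rewrite (set_nth_default (d a)) ?Ik.
Qed.

Lemma extmap_basis_minor A I J k (d : 'I_k -> 'I_n) : #|I| = k -> #|J| = k ->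
  extmap A (e I) J =
  \det (\matrix_(a < k, b < k) A (nth (d a) (enum I) a) (nth (d b) (enum J) b)).
Proof.
move=> Ik Jk; rewrite (extmap_basis_ord _ d Ik) (wedge_evecs_coef _ _ d) Jk eqxx.
congr (\det _); apply/matrixP => a b; rewrite !mxE.
by congr (A _ _); apply: set_nth_default; rewrite -cardE Jk.
Qed.

Lemma extmap_basis_homog A I J : #|I| != #|J| -> extmap A (e I) J = 0.
Proof.
move=> nIJ; rewrite (extmap_basis_ord _ enum_val erefl).
by rewrite (wedge_evecs_coef _ _ enum_val) eq_sym (negPf nIJ).
Qed.

Lemma extmap_basis_tr A I J : extmap A^T (e I) J = extmap A (e J) I.
Proof.
have [IJ|nIJ] := eqVneq #|I| #|J|; last by rewrite !extmap_basis_homog // eq_sym.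
rewrite !(extmap_basis_minor _ enum_val (erefl #|I|)) // -?IJ //.
rewrite (extmap_basis_minor _ enum_val _ (erefl #|I|)) // -det_tr.
by congr (\det _); apply/matrixP => a b; rewrite !mxE.
Qed.

Lemma extmap_coef A x J : extmap A x J = \sum_I x I * extmap A (e I) J.
Proof.
rewrite {1}[x]ext_basisE linear_sum sum_ffunE; apply: eq_bigr => I _.
by rewrite linearZ /= !ffunE.
Qed.

Lemma homog_basis I : homog #|I| (e I).
Proof. by move=> J; rewrite ffunE; case: (J =P I) => [->|_ /eqP]. Qed.

Lemma homog_extmap A k x : homog k x -> homog k (extmap A x).
Proof.
move=> hx J; apply: contraNeq => nJk; rewrite extmap_coef big1 // => I _.
have [-> |/hx Ik] := eqVneq (x I) 0; first by rewrite mul0r.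
by rewrite extmap_basis_homog ?mulr0 // Ik eq_sym.
Qed.

End Minors.

(** A minor of the transpose is the minor with rows and columns exchanged. *)
Lemma extmap_adj (K : comNzRingType) n (A : 'M[K]_n) (x y : ext K n) :
  \sum_J extmap A x J * y J = \sum_J x J * extmap A^T y J.
Proof.
under eq_bigr => J _ do rewrite extmap_coef mulr_suml.
rewrite exchange_big; apply: eq_bigr => I _ /=.
rewrite extmap_coef mulr_sumr; apply: eq_bigr => J _.
by rewrite extmap_basis_tr (mulrC (y J)) mulrA.
Qed.

(** Minors of a matrix are polynomials in its entries.  Used for the inclusion of
    the real numbers into the complex ones, and for complex conjugation. *)
Lemma extmap_map (K K' : comNzRingType) (f : {rmorphism K -> K'}) n
    (A : 'M[K]_n) (x : ext K n) J :
  extmap (map_mx f A) [ffun I => f (x I)] J = f (extmap A x J).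
Proof.
rewrite extmap_coef [extmap A x J]extmap_coef rmorph_sum; apply: eq_bigr => I _.
rewrite ffunE rmorphM; congr (_ * _).
have [IJ|nIJ] := eqVneq #|I| #|J|; last by rewrite !extmap_basis_homog // rmorph0.
rewrite !(extmap_basis_minor _ enum_val (erefl #|I|)) // -det_map_mx.
by congr (\det _); apply/matrixP => a b; rewrite !mxE.
Qed.

Lemma extmap_basis_map (K K' : comNzRingType) (f : {rmorphism K -> K'}) n
    (A : 'M[K]_n) (I J : {set 'I_n}) :
  extmap (map_mx f A) (ext_basis K' I) J = f (extmap A (ext_basis K I) J).
Proof.
rewrite -extmap_map; congr (extmap _ _ _).
by apply/ffunP => L; rewrite !ffunE rmorph_nat.
Qed.

(** * The Hermitean product and superadjoints *)

Section HermitianProduct.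
Variables (R : realType) (n : nat).
Implicit Types (I J : {set 'I_n}) (G A : 'M[R]_n) (x y : ext R[i] n).

Definition extmapC A : ext R[i] n -> ext R[i] n :=
  extmap (map_mx (real_complex R) A).

HB.instance Definition _ A := GRing.Linear.on (extmapC A).

Lemma extmapC_complexify A (eta : ext R n) :
  extmapC A (complexify eta) = complexify (extmap A eta).
Proof.
apply/ffunP => J; rewrite [RHS]ffunE; exact: (extmap_map (real_complex R)).
Qed.

Lemma extmapC_comp A B x : extmapC A (extmapC B x) = extmapC (B *m A) x.
Proof. by rewrite /extmapC extmap_comp map_mxM. Qed.

Lemma extmapC_id x : extmapC 1%:M x = x.
Proof. by rewrite /extmapC map_mx1 extmap_id. Qed.

Lemma gram_minorE G I J : gram_minor G I J = extmap G (ext_basis R I) J.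
Proof.
rewrite /gram_minor; case: eqP => [IJ|/eqP nIJ]; last by rewrite extmap_basis_homog.
rewrite (extmap_basis_minor _ enum_val (erefl #|I|)) //.
congr (\det _); apply/matrixP => a b; rewrite !mxE -enum_val_nth.
by congr (G _ _); apply: set_nth_default; rewrite -cardE -IJ.
Qed.

(** Gram minors are the coefficients of [extmap G], so that statements on the
    Hermitean product reduce to functoriality of induced maps. *)
Lemma hdotE G x y : hdot G x y = \sum_J extmapC G x J * (y J)^*.
Proof.
rewrite /hdot exchange_big; apply: eq_bigr => J _ /=.
rewrite [extmapC _ _ _]extmap_coef mulr_suml; apply: eq_bigr => I _.
by rewrite gram_minorE (extmap_basis_map (real_complex R)) (mulrC (x I)).
Qed.

Definition ext_conj y : ext R[i] n := [ffun J => (y J)^*].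

Lemma extmapC_conj A y : extmapC A (ext_conj y) = ext_conj (extmapC A y).
Proof.
apply/ffunP => J; rewrite [RHS]ffunE /extmapC.
rewrite {1}(_ : map_mx (real_complex R) A = map_mx (@conjc R) (map_mx (real_complex R) A)).
  exact: (extmap_map (@conjc R)).
by apply/matrixP => a b; rewrite !mxE; exact/esym/conjc_real.
Qed.

Lemma extmapC_adj A x y :
  \sum_J extmapC A x J * (y J)^* = \sum_J x J * (extmapC A^T y J)^*.
Proof.
transitivity (\sum_J extmapC A x J * ext_conj y J).
  by apply: eq_bigr => J _; rewrite [ext_conj y J]ffunE.
rewrite /extmapC extmap_adj map_trmx; apply: eq_bigr => J _; congr (_ * _).
rewrite -[extmap _ (ext_conj y)]/(extmapC A^T (ext_conj y)) extmapC_conj; exact: ffunE.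
Qed.

(** Moving A to the left turns [extmapC G] into the map induced by A G A^T. *)
Lemma hdot_isometry G A x y : A *m G *m A^T = G ->
  hdot G (extmapC A x) (extmapC A y) = hdot G x y.
Proof.
move=> AGA; rewrite !hdotE -{2}[A]trmxK -extmapC_adj.
by rewrite !extmapC_comp mulmxA AGA.
Qed.

(** Pairing with [extmapC (invmx G)] of a basis element reads off a coefficient;
    this test form is homogeneous, as are the forms that define superadjoints. *)
Lemma hdot_inj G y z : G \in unitmx ->
  (forall k x, homog k x -> hdot G x y = hdot G x z) -> y = z.
Proof.
move=> uG yz; apply/ffunP => J.
have coef w : hdot G (extmapC (invmx G) (ext_basis _ J)) w = (w J)^*.
  rewrite hdotE extmapC_comp mulVmx // extmapC_id (bigD1 J) //= big1 ?addr0.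
    by rewrite ffunE eqxx mul1r.
  by move=> I /negPf nIJ; rewrite ffunE nIJ mul0r.
apply: (can_inj (@conjcK R)); rewrite -!coef.
by apply: yz; apply: homog_extmap; exact: homog_basis.
Qed.

(** Up to the sign (-1)^(d k), the products (E x', psi E y) and (E x', E psi y)
    are (phi E x', E y) = (E phi x', E y) and (phi x', y), which agree; and every
    homogeneous form is some E x'. *)
Lemma superadjoint_commute G d (phi : ext R[i] n -> ext R[i] n)
    (psi E : {linear ext R[i] n -> ext R[i] n}) :
  G \in unitmx -> superadjoint G d phi psi ->
  (forall x y, hdot G (E x) (E y) = hdot G x y) ->
  (forall k x, homog k x -> homog k (E x)) ->
  (forall k x, homog k x -> exists2 x', homog k x' & E x' = x) ->
  (forall x, phi (E x) = E (phi x)) ->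
  forall x, psi (E x) = E (psi x).
Proof.
move=> uG adj isoE homE surjE phiE.
apply: (ext_lin_eq (f := psi \o E) (g := E \o psi)) => I /=.
have := @homog_basis R[i] n I; move: (ext_basis _ I) => y hy.
apply: (hdot_inj uG) => k x /surjE[x' hx' <-]; rewrite isoE.
apply: (@mulfI _ ((-1) ^+ (d * k))); first by rewrite signr_eq0.
rewrite -(adj _ _ _ _ hx' hy) -(adj _ _ _ _ (homE _ _ hx') (homE _ _ hy)).
by rewrite phiE isoE.
Qed.

Lemma superadjoint_extmapC G A d (phi : ext R[i] n -> ext R[i] n)
    (psi : {linear ext R[i] n -> ext R[i] n}) :
  G \in unitmx -> A *m G *m A^T = G -> superadjoint G d phi psi ->
  (forall x, phi (extmapC A x) = extmapC A (phi x)) ->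
  forall x, psi (extmapC A x) = extmapC A (psi x).
Proof.
move=> uG AGA adj phiA.
have uA : A \in unitmx.
  by move: uG; rewrite -{1}AGA !unitmx_mul => /andP[/andP[]].
apply: (superadjoint_commute (E := extmapC A) uG adj) => //.
- by move=> x y; exact: hdot_isometry.
- by move=> k x; exact: homog_extmap.
move=> k x hx; exists (extmapC (invmx A) x); first exact: homog_extmap.
by rewrite -[LHS]/(extmapC A (extmapC (invmx A) x)) extmapC_comp mulVmx // extmapC_id.
Qed.

End HermitianProduct.

(** * Rotations of orthonormal coframes *)

(** Multiplicativity of determinants, read on the coefficients. *)
Lemma wedge_evecs_mul (K : comNzRingType) n k (m : 'M[K]_k) (u : 'I_k -> 'rV[K]_n.+1) :
  \big[@wedge K n.+1/ext1 K n.+1]_(a < k) evec (\sum_(b < k) m a b *: u b) =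
  \det m *: \big[@wedge K n.+1/ext1 K n.+1]_(a < k) evec (u a).
Proof.
apply/ffunP => J; rewrite !ffunE !(wedge_evecs_coef _ _ (fun=> ord0)).
case: eqP => _; last by rewrite [RHS]mulr0.
rewrite [RHS]/GRing.scale /= -det_mulmx; congr (\det _).
apply/matrixP => a b; rewrite !mxE summxE; apply: eq_bigr => c _.
by rewrite !mxE.
Qed.

Section AlternatingMatrix.
Variables (K : comNzRingType) (n : nat).

(** The skew-symmetric matrix of the bilinear form given by the degree two part. *)
Definition alt_mx (x : ext K n) : 'M[K]_n :=
  \matrix_(a, b) if (a < b)%N then x [set a; b]
                 else if (b < a)%N then - x [set a; b] else 0.

Fact alt_mx_is_linear : linear alt_mx.
Proof.
move=> c x y; apply/matrixP => a b; rewrite !mxE !ffunE.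
case: ltngtP => _; rewrite ?mulr0 ?addr0 // opprD mulrN //.
Qed.

HB.instance Definition _ :=
  GRing.isLinear.Build K (ext K n) 'M[K]_n _ alt_mx alt_mx_is_linear.

Lemma alt_mx_wedge (u w : 'rV[K]_n) :
  alt_mx (wedge (evec u) (evec w)) = u^T *m w - w^T *m u.
Proof.
have evecE (v : 'rV_n) b : evec v [set b] = v 0 b.
  rewrite /evec sum_ffunE (bigD1 b) //= big1 => [|c nc].
    by rewrite !ffunE eqxx addr0 [LHS]mulr1.
  by rewrite !ffunE (inj_eq set1_inj) eq_sym (negPf nc); exact: mulr0.
have coefE a b : a != b -> wedge (evec u) (evec w) [set a; b] =
    u 0 a * ((-1) ^+ (b < a)%N * w 0 b) + u 0 b * ((-1) ^+ (a < b)%N * w 0 a).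
  move=> nab; rewrite evec_wedgeE big_setU1 ?big_set1 ?inE //=.
  rewrite setU1K ?inE // [[set a; b]]setUC setU1K ?inE 1?eq_sym //.
  by rewrite !ext_signE !big_set1 !evecE.
apply/matrixP => a b; rewrite !mxE !big_ord1 !mxE.
case: ltngtP => [ltab|ltba|/val_inj->]; last by rewrite mulrC subrr.
  rewrite coefE ?neq_ltn ?ltab // ltnNge ltnW //= expr0 expr1 mul1r mulN1r mulrN.
  by rewrite [u 0 b * _]mulrC.
rewrite coefE ?neq_ltn ?ltba ?orbT // [(a < b)%N]ltnNge ltnW //=.
by rewrite expr0 expr1 mul1r mulN1r mulrN opprD opprK [u 0 b * _]mulrC.
Qed.

Lemma alt_mx_tr (x : ext K n) : (alt_mx x)^T = - alt_mx x.
Proof.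
apply/matrixP => a b; rewrite !mxE [[set b; a]]setUC.
by case: ltngtP; rewrite ?opprK ?oppr0.
Qed.

End AlternatingMatrix.

Section Coframes.
Variable R : realType.
Implicit Types (v w : coframe R) (g : 'M[R]_3) (G : 'M[R]_9) (i j : 'I_3).

Definition orthonormal_coframe G v : Prop :=
  forall i j i' j', (v i j *m G *m (v i' j')^T) 0 0 = ((i == i') && (j == j'))%:R.

(** The covectors of W_j as rows: adapted coframes are studied through these three
    3 x 9 blocks. *)
Definition coframe_part v j : 'M[R]_(3, 9) := \matrix_i v i j.

Definition rotate v g : coframe R := fun i j => \sum_(k < 3) g k i *: v k j.

Lemma gram_entry m1 m2 n (A : 'M[R]_(m1, n)) (H : 'M[R]_n) (B : 'M[R]_(m2, n)) k l :
  (A *m H *m B^T) k l = (row k A *m H *m (row l B)^T) 0 0.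
Proof.
by rewrite -row_mul [LHS]mxE [RHS]mxE; apply: eq_bigr => c _; rewrite !mxE.
Qed.

Lemma orthonormal_part G v : orthonormal_coframe G v <->
  forall j j', coframe_part v j *m G *m (coframe_part v j')^T = (j == j')%:R%:M.
Proof.
split=> [ov j j'|ov i j i' j'].
  apply/matrixP => i i'; rewrite gram_entry !rowK ov !mxE.
  by case: eqP => _; case: eqP.
have /matrixP/(_ i i') := ov j j'; rewrite gram_entry !rowK => ->; rewrite !mxE.
by case: eqP => _; case: eqP.
Qed.

Lemma coframe_mx_row v i j :
  v i j = row (inord (3 * j + i)) (coframe_mx v).
Proof.
have lt9 : (3 * j + i < 9)%N by case: i j => -[|[|[|//]]] ? -[[|[|[|//]]] ?].
rewrite rowK !inordK // mulnC modnMDl modn_small // divnMDl // divn_small // addn0.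
by rewrite !inord_val.
Qed.

Lemma coframe_mx_parts v : coframe_mx v =
  col_mx (coframe_part v (inord 0))
    (col_mx (coframe_part v (inord 1)) (coframe_part v (inord 2))) :> 'M[R]_(3 + (3 + 3), 9).
Proof.
apply/row_matrixP => k; rewrite rowK.
rewrite -(fintype.splitK k); case: (fintype.split k) => [a|b] /=.
  rewrite rowKu rowK modn_small // divn_small //; congr (v _ _).
  by rewrite inord_val.
rewrite rowKd -(fintype.splitK b); case: (fintype.split b) => [a|a] /=.
  rewrite rowKu rowK /= modnDl modn_small // divnDl // divnn.
  by rewrite (divn_small (ltn_ord a)) inord_val.
rewrite rowKd rowK /= !modnDl modn_small // !divnDl // divnn.
by rewrite (divn_small (ltn_ord a)) inord_val.
Qed.

Lemma orthonormal_coframe_mx G v : orthonormal_coframe G v ->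
  coframe_mx v *m G *m (coframe_mx v)^T = 1%:M.
Proof.
move=> ov; apply/matrixP => k l; rewrite gram_entry !rowK ov !mxE.
congr (nat_of_bool _)%:R; rewrite -!(inj_eq val_inj) /= !inordK ?ltn_mod ?ltn_divLR //.
apply/andP/eqP => [[/eqP E1 /eqP E2]|-> //].
by rewrite (divn_eq k 3) (divn_eq l 3) E1 E2.
Qed.

Lemma coframe_part_rotate v g j :
  coframe_part (rotate v g) j = g^T *m coframe_part v j.
Proof.
apply/row_matrixP => i; rewrite rowK row_mul mulmx_sum_row.
by apply: eq_bigr => k _; rewrite rowK !mxE.
Qed.

Lemma orthonormal_rotate G v g : SO3 g -> orthonormal_coframe G v ->
  orthonormal_coframe G (rotate v g).
Proof.
move=> [gg _] /orthonormal_part ov; apply/orthonormal_part => j j'.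
rewrite !coframe_part_rotate trmx_mul trmxK -!mulmxA (mulmxA G) (mulmxA (coframe_part v j)).
rewrite (mulmxA (coframe_part v j)) ov.
by rewrite mul_scalar_mx -scalemxAr (mulmx1C gg) scalemx1.
Qed.

End Coframes.

(** * Invariance and uniqueness of the forms of a coframe *)

Section CoframeForms.
Variable R : realType.
Implicit Types (v w : coframe R) (g : 'M[R]_3) (G : 'M[R]_9) (i j : 'I_3).

Lemma pair_form_rotate v g j j' : SO3 g ->
  pair_form (rotate v g) j j' = pair_form v j j'.
Proof.
move=> [gg _]; rewrite /pair_form.
under eq_bigr => i _ do rewrite !(linear_sum (@evec R 9)) wedge_suml /=.
rewrite exchange_big /=; apply: eq_bigr => k _.
under eq_bigr => i _ do rewrite (linear_sum (wedge _)) /=.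
rewrite exchange_big (bigD1 k) //= [X in _ + X]big1 => [|l nlk].
  rewrite addr0; under eq_bigr => i _ do rewrite !linearZ /= wedgeZl linearZ /= scalerA.
  rewrite -scaler_suml (_ : \sum_i _ = 1) ?scale1r //.
  move/matrixP: gg => /(_ k k); rewrite !mxE eqxx => gkk; apply: etrans gkk.
  by apply: eq_bigr => i _; rewrite mxE.
under eq_bigr => i _ do rewrite !linearZ /= wedgeZl linearZ /= scalerA.
rewrite -scaler_suml (_ : \sum_i _ = 0) ?scale0r //.
move/matrixP: gg => /(_ k l); rewrite !mxE eq_sym (negPf nlk) => gkl; apply: etrans gkl.
by apply: eq_bigr => i _; rewrite mxE.
Qed.

Lemma coframe_volE v j :
  coframe_vol v j = \big[@wedge R 9/ext1 R 9]_(a < 3) evec (v a j).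
Proof.
rewrite !big_ord_recl big_ord0 wedge1r.
by congr (wedge (evec (v _ _)) (wedge (evec (v _ _)) (evec (v _ _))));
  apply: val_inj; rewrite /= inordK.
Qed.

Lemma coframe_vol_mul v w j (m : 'M[R]_3) :
  coframe_part w j = m *m coframe_part v j ->
  coframe_vol w j = \det m *: coframe_vol v j.
Proof.
move=> wE; rewrite !coframe_volE -wedge_evecs_mul; apply: eq_bigr => a _.
congr (evec _); have := congr1 (row a) wE; rewrite rowK row_mul mulmx_sum_row => ->.
by apply: eq_bigr => k _; rewrite rowK !mxE.
Qed.

Lemma coframe_vol_rotate v g j : SO3 g ->
  coframe_vol (rotate v g) j = coframe_vol v j.
Proof.
move=> [_ dg]; rewrite (coframe_vol_mul (coframe_part_rotate v g j)).
by rewrite det_tr dg scale1r.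
Qed.

Lemma coframe_mx_unit G v : orthonormal_coframe G v -> coframe_mx v \in unitmx.
Proof. by move/orthonormal_coframe_mx; rewrite -mulmxA => /mulmx1_unit[]. Qed.

Lemma extmap_so3 G v g i j : orthonormal_coframe G v ->
  extmap (so3_mx v g) (evec (v i j)) = evec (rotate v g i j).
Proof.
move=> ov; rewrite extmap_evec mulmxA (coframe_mx_row v) -row_mul.
by rewrite mulmxV ?(coframe_mx_unit ov) // -row_mul mul1mx -coframe_mx_row.
Qed.

(** The matrix of the rotation is the change of basis between two orthonormal
    coframes. *)
Lemma so3_mx_isometry G v g : orthonormal_coframe G v -> SO3 g ->
  so3_mx v g *m G *m (so3_mx v g)^T = G.
Proof.
move=> ov hg; have uV := coframe_mx_unit ov.
have VV := orthonormal_coframe_mx ov.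
have := orthonormal_coframe_mx (orthonormal_rotate hg ov).
rewrite /so3_mx -[coframe_mx (fun _ _ => _)]/(coframe_mx (rotate v g)).
set V := coframe_mx v in uV VV *; set V' := coframe_mx _ => VV'.
rewrite trmx_mul mulmxA -[invmx V *m V' *m G]mulmxA -(mulmxA (invmx V)) VV' mulmx1.
have uVT : V^T \in unitmx by rewrite unitmx_tr.
apply: (can_inj (mulKmx uV)); apply: (can_inj (mulmxK uVT)).
by rewrite mulKVmx // VV trmx_inv mulVmx.
Qed.

Lemma extmap_so3_pair_form G v g j j' : orthonormal_coframe G v -> SO3 g ->
  extmap (so3_mx v g) (pair_form v j j') = pair_form v j j'.
Proof.
move=> ov hg; rewrite -[RHS](pair_form_rotate _ _ _ hg) /pair_form.
rewrite (linear_sum (extmap _)); apply: eq_bigr => i _ /=.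
by rewrite extmap_wedge !(extmap_so3 _ _ _ ov).
Qed.

Lemma extmap_so3_vol G v g j : orthonormal_coframe G v -> SO3 g ->
  extmap (so3_mx v g) (coframe_vol v j) = coframe_vol v j.
Proof.
move=> ov hg; rewrite -[RHS](coframe_vol_rotate _ _ hg).
by rewrite /coframe_vol !extmap_wedge !(extmap_so3 _ _ _ ov).
Qed.

Lemma alt_mx_pair_form v j j' : alt_mx (pair_form v j j') =
  (coframe_part v j)^T *m coframe_part v j' - (coframe_part v j')^T *m coframe_part v j.
Proof.
rewrite linear_sum /=; under eq_bigr => i _ do rewrite alt_mx_wedge.
apply/matrixP => a b; rewrite summxE !mxE -sumrB; apply: eq_bigr => i _.
by rewrite !mxE !big_ord1 !mxE.
Qed.

(** With respect to an orthonormal coframe and for j != j', the endomorphism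
    G * alt_mx of sum_i v_ij /\ v_ij' maps v_ij to v_ij', v_ij' to - v_ij and the
    remaining covectors to 0.  It depends on the form only, not on the coframe, and so can
    be used to compare coframes. *)
Lemma part_alt_mx G v j j' k : orthonormal_coframe G v ->
  coframe_part v k *m (G *m alt_mx (pair_form v j j')) =
  (k == j)%:R *: coframe_part v j' - (k == j')%:R *: coframe_part v j.
Proof.
move=> /orthonormal_part ov; rewrite alt_mx_pair_form mulmxA mulmxBr !mulmxA !ov.
by rewrite !mul_scalar_mx.
Qed.

Lemma orthonormal_metric_sym G v : orthonormal_coframe G v -> G^T = G.
Proof.
move=> ov; have VV := orthonormal_coframe_mx ov; have uV := coframe_mx_unit ov.
have uVT : (coframe_mx v)^T \in unitmx by rewrite unitmx_tr.
apply: (can_inj (mulKmx uV)); apply: (can_inj (mulmxK uVT)).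
by rewrite VV -[RHS]trmx1 -VV !trmx_mul trmxK mulmxA.
Qed.

(** The kernel of the endomorphism of [part_alt_mx] is orthogonal to its image,
    the endomorphism being skew for the metric. *)
Lemma part_coef_alt_mx G v j j' : orthonormal_coframe G v -> j != j' ->
  forall X : 'M[R]_(3, 9), X *m (G *m alt_mx (pair_form v j j')) = 0 ->
  X *m G *m (coframe_part v j)^T = 0 /\ X *m G *m (coframe_part v j')^T = 0.
Proof.
move=> ov nj X X0.
have trk k : (coframe_part v k *m (G *m alt_mx (pair_form v j j')))^T =
    - (alt_mx (pair_form v j j') *m G *m (coframe_part v k)^T).
  by rewrite !trmx_mul alt_mx_tr (orthonormal_metric_sym ov) !mulNmx.
have Xk k : X *m G *m (coframe_part v k *m (G *m alt_mx (pair_form v j j')))^T = 0.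
  by rewrite trk mulmxN !mulmxA -[X *m G *m _]mulmxA X0 !mul0mx oppr0.
move: (Xk j) (Xk j'); rewrite !(part_alt_mx _ _ _ ov) !eqxx [j' == j]eq_sym (negPf nj).
rewrite !scale1r !scale0r subr0 sub0r linearN /= mulmxN => -> /eqP.
by rewrite oppr_eq0 => /eqP.
Qed.

Lemma orthonormal_expand G v (X : 'M[R]_(3, 9)) : orthonormal_coframe G v ->
  X = X *m G *m (coframe_part v (inord 0))^T *m coframe_part v (inord 0) +
      (X *m G *m (coframe_part v (inord 1))^T *m coframe_part v (inord 1) +
       X *m G *m (coframe_part v (inord 2))^T *m coframe_part v (inord 2)).
Proof.
move=> ov.
pose V : 'M[R]_(3 + (3 + 3), 9) := col_mx (coframe_part v (inord 0))
  (col_mx (coframe_part v (inord 1)) (coframe_part v (inord 2))).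
have GVV : G *m V^T *m V = 1%:M.
  have := orthonormal_coframe_mx ov.
  by rewrite -mulmxA => /mulmx1C; rewrite coframe_mx_parts.
rewrite -{1}[X]mulmx1 -GVV /V.
by rewrite !tr_col_mx !mul_mx_row !mul_row_col !mulmxDr !mulmxA.
Qed.

(** The rows of w in W_0 are killed by the endomorphism of omega_D, hence are
    combinations of the rows of v in W_0, with some matrix b.  The endomorphisms
    of omega_1 and omega_2 transport this relation to W_1 and W_2 with the same
    b, which is orthogonal and, by orientedness, of determinant 1. *)
Lemma oriented_coframe_vol G v w j :
  orthonormal_coframe G v -> orthonormal_coframe G w ->
  0 < \det (coframe_mx v) -> 0 < \det (coframe_mx w) ->
  pair_form v (inord 0) (inord 1) = pair_form w (inord 0) (inord 1) ->
  pair_form v (inord 0) (inord 2) = pair_form w (inord 0) (inord 2) ->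
  pair_form v (inord 1) (inord 2) = pair_form w (inord 1) (inord 2) ->
  coframe_vol v j = coframe_vol w j.
Proof.
move=> ov ow dv dw p1 p2 pD.
pose i0 : 'I_3 := inord 0; pose i1 : 'I_3 := inord 1; pose i2 : 'I_3 := inord 2.
have [n01 n02 n12] : [/\ i0 != i1, i0 != i2 & i1 != i2].
  by split; rewrite -(inj_eq val_inj) /= !inordK.
pose b := coframe_part w i0 *m G *m (coframe_part v i0)^T.
have E0 : coframe_part w i0 = b *m coframe_part v i0.
  rewrite [LHS](orthonormal_expand _ ov).
  have [|-> ->] := part_coef_alt_mx ov n12 (X := coframe_part w i0).
    by rewrite pD (part_alt_mx _ _ _ ow) (negPf n01) (negPf n02) !scale0r subrr.
  by rewrite !mul0mx !addr0.
clearbody b.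
have step k : i0 != k -> pair_form v i0 k = pair_form w i0 k ->
    coframe_part w k = b *m coframe_part v k.
  move=> n0k pk; have := part_alt_mx i0 k i0 ow.
  rewrite eqxx (negPf n0k) scale1r scale0r subr0 => <-.
  rewrite -pk E0 -mulmxA (part_alt_mx _ _ _ ov).
  by rewrite eqxx (negPf n0k) scale1r scale0r subr0.
have Ek k : coframe_part w k = b *m coframe_part v k.
  have [->|n0] := eqVneq k i0; first exact: E0.
  have [->|n1] := eqVneq k i1; first exact: step.
  have [->|n2] := eqVneq k i2; first exact: step.
  move: n0 n1 n2; rewrite -!(inj_eq val_inj) /= !inordK //.
  by case: k => -[|[|[|]]].
have bb : b *m b^T = 1%:M.
  have /orthonormal_part/(_ i0 i0) := ow; rewrite E0 eqxx trmx_mul -!mulmxA.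
  rewrite (mulmxA G) (mulmxA (coframe_part v i0)) (mulmxA (coframe_part v i0)).
  by move/orthonormal_part: ov => ->; rewrite eqxx mul1mx.
have detb : \det b ^+ 2 = 1 by rewrite expr2 -{2}det_tr -det_mulmx bb det1.
(* The change of coframe, b repeated on W_0, W_1 and W_2. *)
pose B : 'M[R]_(3 + (3 + 3)) := block_mx b 0 0 (block_mx b 0 0 b).
have wE : coframe_mx w = B *m coframe_mx v.
  rewrite !coframe_mx_parts !mul_block_col !mul0mx !addr0 !add0r.
  by rewrite !Ek.
have detB : \det B = \det b ^+ 3 by rewrite !det_ublock !exprS expr0 mulr1.
have detb3 : 0 < \det b ^+ 3.
  by move: dw; rewrite wE det_mulmx pmulr_lgt0 // -detB.
have db : \det b = 1.
  move: detb3; rewrite exprS detb mulr1 => db0.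
  by move/eqP: detb; rewrite sqrf_eq1 => /orP[/eqP//|/eqP dbN]; rewrite dbN oppr_gt0 ltr10 in db0.
by rewrite (coframe_vol_mul (Ek j)) db scale1r.
Qed.

End CoframeForms.

(** * The action of the generated superalgebra on a fibre *)

Section FibrewiseAction.
Variables (R : realType) (X : topologicalType) (W : wsd_manifold R X) (p : X).
Implicit Types (v : coframe R) (g : 'M[R]_3) (j : 'I_3) (x y : ext R[i] 9).

Definition commutes_at (D : cforms W -> cforms W) : Prop :=
  exists T : {linear ext R[i] 9 -> ext R[i] 9},
    (forall alpha : cforms W, D alpha p = T (alpha p)) /\
    (forall (v : coframe R) (g : 'M[R]_3), oriented_coframe W p v -> SO3 g ->
       forall x : ext R[i] 9, T (so3_act v g x) = so3_act v g (T x)).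

Lemma oriented_orthonormal v : oriented_coframe W p v ->
  orthonormal_coframe (invmx (metric W p)) v.
Proof. by case=> -[]. Qed.

Lemma metric_unit v : oriented_coframe W p v -> invmx (metric W p) \in unitmx.
Proof.
move=> /oriented_orthonormal/orthonormal_coframe_mx.
by rewrite -mulmxA => /mulmx1_unit[_]; rewrite unitmx_mul => /andP[].
Qed.

Lemma extmap_so3_Lform v g j : oriented_coframe W p v -> SO3 g ->
  extmap (so3_mx v g) (Lform W p j) = Lform W p j.
Proof.
move=> ov hg; have on := oriented_orthonormal ov.
case: ov => -[_ E1 E2 ED] _; rewrite /Lform.
by case: (val j) => [|[|_]]; rewrite ?linearN /= ?E1 ?E2 ?ED
  (extmap_so3_pair_form _ _ on hg).
Qed.

Lemma extmap_so3_is_vol v g j (eta : ext R 9) : oriented_coframe W p v -> SO3 g ->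
  is_vol W p j eta -> extmap (so3_mx v g) eta = eta.
Proof.
move=> ov hg [w ow ->]; have onv := oriented_orthonormal ov.
have onw := oriented_orthonormal ow.
case: (ov) => -[_ v1 v2 vD] dv; case: (ow) => -[_ w1 w2 wD] dw.
rewrite -(oriented_coframe_vol j onv onw dv dw) -?v1 -?v2 -?vD //.
exact: extmap_so3_vol onv hg.
Qed.

Lemma wedge_op_so3 v g (eta : ext R 9) x : extmap (so3_mx v g) eta = eta ->
  wedge_op eta (so3_act v g x) = so3_act v g (wedge_op eta x).
Proof.
move=> eta_g; rewrite /wedge_op /so3_act extmap_wedge.
by rewrite -/(extmapC _ (complexify eta)) extmapC_complexify eta_g.
Qed.

(** Superadjoints are unique, so they inherit the symmetry of the wedge product. *)
Lemma star_so3 d (eta : X -> ext R 9) psi v g : oriented_coframe W p v -> SO3 g ->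
  extmap (so3_mx v g) (eta p) = eta p ->
  is_star W d (fun q => wedge_op (eta q)) psi ->
  forall x, psi p (so3_act v g x) = so3_act v g (psi p x).
Proof.
move=> ov hg eta_g star; apply: (superadjoint_extmapC (metric_unit ov) _ (star p)).
  exact: so3_mx_isometry (oriented_orthonormal ov) hg.
by move=> x; apply: wedge_op_so3.
Qed.

Lemma so3_act_scale v g (c : R[i]) x : so3_act v g (c *: x) = c *: so3_act v g x.
Proof. exact: (linearZ_LR (extmap _)). Qed.

Lemma so3_actD v g x y : so3_act v g (x + y) = so3_act v g x + so3_act v g y.
Proof. exact: (linearD (extmap _)). Qed.

Lemma generator_commutes_at D : wsd_generator D -> commutes_at D.
Proof.
case=> {D} [j D DE|j eta D vol DE|j psi D star DE|j eta psi D vol star DE].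
- exists ('i \*: wedge (complexify (Lform W p j))); split=> [alpha|v g ov hg x].
    exact: DE.
  rewrite /= so3_act_scale -/(wedge_op _ _) -/(wedge_op _ x).
  by rewrite wedge_op_so3 // extmap_so3_Lform.
- exists ('i \*: wedge (complexify (eta p))); split=> [alpha|v g ov hg x].
    exact: DE.
  rewrite /= so3_act_scale -/(wedge_op _ _) -/(wedge_op _ x).
  by rewrite wedge_op_so3 // (extmap_so3_is_vol ov hg (vol p)).
- exists ('i \*: psi p); split=> [alpha|v g ov hg x]; first exact: DE.
  rewrite /= so3_act_scale (star_so3 (eta := fun q => Lform W q j) ov hg _ star) //.
  exact: extmap_so3_Lform.
exists (psi p); split=> [alpha|v g ov hg x]; first exact: DE.
by apply: (star_so3 (eta := eta) ov hg _ star); apply: extmap_so3_is_vol (vol p).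
Qed.

End FibrewiseAction.

(* Every element D of L_3 acts on the fibre at p by a linear operator T, and T
   commutes with the action of SO(3, R) defined by any adapted coframe. *)
Theorem theorem3p1 (R : realType) (X : topologicalType) (W : wsd_manifold R X)
    (D : cforms W -> cforms W) (p : X) :
  L3 D ->
  exists T : {linear ext R[i] 9 -> ext R[i] 9},
    (forall alpha : cforms W, D alpha p = T (alpha p)) /\
    (forall (v : coframe R) (g : 'M[R]_3), oriented_coframe W p v -> SO3 g ->
       forall x : ext R[i] 9, T (so3_act v g x) = so3_act v g (T x)).
Proof.
elim=> {D} [D|||r D _ [T [TD Tg]]|a b D E _ [T [TD Tg]] _ [S [SE Sg]] _ _].
- exact: generator_commutes_at.
- exists (\0%R); split=> [alpha|v g _ _ x]; first by [].
  by rewrite [RHS](linear0 (extmap _)).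
- move=> D E _ [T [TD Tg]] _ [S [SE Sg]].
  exists (T \+ S); split=> [alpha|v g ov hg x] /=.
    by rewrite -TD -SE.
  by rewrite so3_actD Tg // Sg.
- exists (r%:C \*: T); split=> [alpha|v g ov hg x] /=; first by rewrite -TD.
  by rewrite so3_act_scale Tg.
exists ((T \o S) \+ ((- (-1) ^+ (a && b)) \*: (S \o T))).
split=> [alpha|v g ov hg x] /=.
  by rewrite scaleNr -SE -TD -TD -SE.
by rewrite so3_actD so3_act_scale !(Sg, Tg).
Qed.
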